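(* Let $\Omega\subset\mathbb{R}^3$ be a nonempty bounded open domain, $G,c>0$, $\mu\in L^1(\Omega)$ with $\mu\ge 0$, and $M=\int_\Omega\mu(x)\,dx>0$. Assume that there is no gravitational mass except that in $\Omega$. Let $B$ be a closed ball containing $\overline{\Omega}$ such that $$c^2\,\mathrm{diam}(B)<2GM.$$ Then $B$ is a black hole. More precisely, if a photon enters the region $B$ at some time $t_0$ (so $u(t_0)\in B$), then either the photon disappears in finite time, or its position $u(t)$ satisfies $$\forall t\ge t_0,\quad \mathrm{dist}(u(t),\overline{\Omega})\le\frac{\mathrm{diam}(B)}{1-\frac{c^2\,\mathrm{diam}(B)}{2GM}}.$$
   Context: $\|\cdot\|$ is the Euclidean norm on $\mathbb{R}^3$, $\mathrm{dist}(u,\overline{\Omega})=\min_{x\in\overline{\Omega}}\|u-x\|$, $\mathrm{diam}$ is the diameter, $G$ is the gravitational constant, $c$ the velocity of light, $\mu$ the local density of the mass $M$ in $\Omega$. Since there is no other mass, any point particle (in particular a photon, treated as a Newtonian particle) located outside $\overline{\Omega}$ moves according to $$(\ast)\qquad u''=-\int_\Omega\frac{G\mu(x)(u-x)}{\|u-x\|^3}\,dx .$$ Photon: it may hit $\overline{\Omega}$, where it may disappear for ever (be absorbed) or stay some time and come out again; no equation is imposed inside $\overline{\Omega}$. A photon that enters $B$ at time $t_0$ and does not disappear in finite time is described by a continuous $u:[t_0,\infty)\to\mathbb{R}^3$ with $u(t_0)\in B$ such that, on each connected component $I$ of $\{t\ge t_0: u(t)\notin\overline{\Omega}\}$, $u$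 is $C^2$ and satisfies $(\ast)$ (one-sided derivatives at $t_0$ if $t_0\in I$), and $\limsup_{t\downarrow \inf I}\|u'(t)\|\le c$ (the photon enters at $t_0$, or leaves the matter, with speed at most $c$). A black hole is a massive body whose escape velocity exceeds $c$. Explicitly, $B$ is a black hole if for every $u_0\in B$ there is $V>c$ such that every trajectory starting at $u_0$ with initial speed less than $V$ is bounded. Here a trajectory starting at $u_0$ with initial speed less than $V$ is a continuous $u:[0,T)\to\mathbb{R}^3$, $0<T\le\infty$, with $u(0)=u_0$, such that for $t\in(0,T)$ one has $u(t)\notin\overline{\Omega}$, $u$ is $C^2$ and satisfies $(\ast)$, and $\limsup_{t\downarrow0}\|u'(t)\|<V$. *)

(* Defs.v *)
From HB Require Import structures.
From mathcomp Require Import all_boot all_order all_algebra.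
From mathcomp Require Import all_classical all_reals all_analysis.

Set Implicit Arguments.
Unset Strict Implicit.
Unset Printing Implicit Defensive.

Import Order.TTheory GRing.Theory Num.Theory.
Import numFieldNormedType.Exports.

Local Open Scope classical_set_scope.
Local Open Scope ring_scope.

(* R^3 as an iterated product, which carries both the product topology and the
   product Borel sigma-algebra.  The library norm `|x| on this type is the
   sup norm, so the Euclidean norm is [enorm]; both give the same topology. *)
Definition vec3 (R : realType) := (R * R * R)%type.

Definition leb3 (R : realType) :
    {measure set (measurableTypeR R * measurableTypeR R * measurableTypeR R)
       -> \bar R} :=
  ((@lebesgue_measure R \x @lebesgue_measure R) \x @lebesgue_measure R)%E.

Section Geometry.
Context {R : realType}.
Implicit Types (x : vec3 R) (A : set (vec3 R)).

Definition enorm x : R := Num.sqrt (x.1.1 ^+ 2 + x.1.2 ^+ 2 + x.2 ^+ 2).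

Definition closed_eball (a : vec3 R) (r : R) : set (vec3 R) :=
  [set x | enorm (x - a) <= r].

Definition ebounded A := exists K : R, forall x, A x -> enorm x <= K.

Definition diam A : R := sup [set enorm (p.1 - p.2) | p in A `*` A].

(* The infimum is a minimum when A is nonempty and closed. *)
Definition dist x A : R := inf [set enorm (x - y) | y in A].

Definition vintegral A (f : vec3 R -> vec3 R) : vec3 R :=
  (Rintegral (leb3 R) A (fun x => (f x).1.1),
   Rintegral (leb3 R) A (fun x => (f x).1.2),
   Rintegral (leb3 R) A (fun x => (f x).2)).

End Geometry.

Section Motion.
Context {R : realType}.
Implicit Types (u v a : R -> vec3 R) (A I : set R).

(* v is the derivative of u at every point of A, difference quotients being
   taken inside A: one-sided at an end point of A lying in A, and the usual
   derivative at interior points. *)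
Definition is_derivative_on A u v :=
  forall t, A t ->
    (t' - t)^-1 *: (u t' - u t) @[t' --> within A t^'] --> v t.

Definition is_C2_on A u v a :=
  [/\ is_derivative_on A u v, is_derivative_on A v a
    & {within A, continuous a}].

Variables (G c : R) (Omega : set (vec3 R)) (mu : vec3 R -> R).

Definition mass : R := Rintegral (leb3 R) Omega mu.

Definition acceleration (u : vec3 R) : vec3 R :=
  - vintegral Omega (fun x => (G * mu x / enorm (u - x) ^+ 3) *: (u - x)).

(* u moves in A, with velocity v, under the gravitation of Omega alone. *)
Definition newtonian_on A u v :=
  exists2 a, is_C2_on A u v a & forall t, A t -> a t = acceleration (u t).

Definition limsup_speed v (t0 : R) : \bar R :=
  limf_esup (fun t => (enorm (v t))%:E) t0^'+.

(* A trajectory on [0, T[, with 0 < T <= +oo, of initial speed less than V. *)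
Definition trajectory (u0 : vec3 R) (V : R) (T : \bar R) u :=
  let A := [set t : R | 0 < t /\ (t%:E < T)%E] in
  [/\ (0%:E < T)%E,
      {within [set t : R | 0 <= t /\ (t%:E < T)%E], continuous u},
      u 0 = u0,
      forall t, A t -> ~ closure Omega (u t)
    & exists2 v, newtonian_on A u v & (limsup_speed v 0 < V%:E)%E].

Definition black_hole (B : set (vec3 R)) :=
  forall u0 : vec3 R, B u0 -> exists2 V : R, c < V &
    forall T u, trajectory u0 V T u ->
      ebounded (u @` [set t : R | 0 <= t /\ (t%:E < T)%E]).

(* A photon that enters B at time t0 and exists up to time T, inclusive if T is
   finite; it never disappears if T = +oo, and otherwise it is absorbed by the
   matter at time T.  No equation is imposed while it is in the matter. *)
Definition photon (B : set (vec3 R)) (t0 : R) (T : \bar R) u :=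
  let life := [set t : R | t0 <= t /\ (t%:E <= T)%E] in
  let free := [set t | life t /\ ~ closure Omega (u t)] in
  [/\ (t0%:E <= T)%E,
      forall s : R, T = s%:E -> closure Omega (u s),
      {within life, continuous u},
      B (u t0)
    & forall s, free s -> let I := connected_component free s in
        exists2 v, newtonian_on I u v & (limsup_speed v (inf I) <= c%:E)%E].

End Motion.

(* Main.v *)
Require Import Defs.
From HB Require Import structures.
From mathcomp Require Import all_boot all_order all_algebra.
From mathcomp Require Import all_classical all_reals all_analysis.
From mathcomp Require Import measurable_realfun.
From mathcomp Require Import ring lra.

Set Implicit Arguments.
Unset Strict Implicit.
Unset Printing Implicit Defensive.

Import Order.TTheory GRing.Theory Num.Theory.
Import numFieldNormedType.Exports.

Local Open Scope classical_set_scope.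
Local Open Scope ring_scope.

(** The proof is conservation of energy.  Outside [closure Omega] the field is
    the gradient of the Newtonian potential [G * potential u], where
    [potential u] is the integral of [mu x / enorm (u - x)] over [Omega], so
    the energy [enorm (v t) ^+ 2 / 2 - G * potential (u t)] is constant along
    every free flight ([energy_constant]).

    Write [D] for the diameter of [B] and [M] for the mass.  A free flight
    starts in [B]: a photon enters in [B] or leaves the matter, which lies in
    [B].  Every point of [Omega] is then at distance at most [D], so the
    potential is at least [M / D] in the limit, and the energy is at most
    [c ^+ 2 / 2 - G * M / D] ([energy_le]); this is negative by assumption.
    At any later time the kinetic energy is nonnegative and the potential is at
    most [M / dist], hence [(G * M / D - c ^+ 2 / 2) * dist <= G * M]
    ([dist_le_energy]), and solving for [dist] gives the bound
    ([free_flight_bound]).  The initial bounds are only limits from the right,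
    as the flight may start on the boundary of the matter, where the potential
    itself is not controlled; the argument is therefore run at nearby later
    times with [D + e] and [c + e], and [e] is sent to [0] at the end.

    For the potential no differentiation under the integral sign is used: the
    quadratic remainder in the expansion of [1 / enorm (u - x)] is bounded
    uniformly in [x] at positive distance from [closure Omega]
    ([inv_enorm_taylor]), and integrating that bound against [mu] gives the
    expansion of the potential ([potential_taylor]).

    The black hole property follows with [c] replaced by some [V > c] which
    still satisfies [V ^+ 2 * D < 2 * G * M].  For the photon it remains to
    locate the start of the flight: the left end of a connected component of
    the free times is either the entrance time or a time spent in the matter
    ([component_ends]). *)

(** * Euclidean geometry of the space *)

Section EuclideanNorm.
Context {R : realType}.
Implicit Types x y z h : vec3 R.

Definition dot x y : R := x.1.1 * y.1.1 + x.1.2 * y.1.2 + x.2 * y.2.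

Lemma dotC x y : dot x y = dot y x.
Proof. by rewrite /dot mulrC [_ * y.1.2]mulrC [_ * y.2]mulrC. Qed.

Lemma dotZl k x y : dot (k *: x) y = k * dot x y.
Proof. by rewrite /dot !mulrDr !mulrA. Qed.

Lemma enorm_ge0 x : 0 <= enorm x.
Proof. exact: sqrtr_ge0. Qed.

Lemma enorm_sqr x : enorm x ^+ 2 = dot x x.
Proof. by rewrite sqr_sqrtr ?addr_ge0 ?sqr_ge0// /dot !expr2. Qed.

Lemma enorm0 : enorm (0 : vec3 R) = 0.
Proof. by rewrite /enorm/= expr0n/= !addr0 sqrtr0. Qed.

Lemma le_of_sqr (a b : R) : 0 <= b -> a ^+ 2 <= b ^+ 2 -> a <= b.
Proof. by move=> b0 ab; nra. Qed.

(** Cauchy-Schwarz, from the three squares of the Lagrange identity. *)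
Lemma dot_le x y : `|dot x y| <= enorm x * enorm y.
Proof.
apply: le_of_sqr; first by rewrite mulr_ge0 ?enorm_ge0.
rewrite exprMn !enorm_sqr real_normK ?num_real// /dot.
move: x y => [[x1 x2] x3] [[y1 y2] y3] /=.
have := sqr_ge0 (x1 * y2 - x2 * y1); have := sqr_ge0 (x1 * y3 - x3 * y1).
have := sqr_ge0 (x2 * y3 - x3 * y2); nra.
Qed.

Lemma enormD x y : enorm (x + y) <= enorm x + enorm y.
Proof.
apply: le_of_sqr; first by rewrite addr_ge0 ?enorm_ge0.
have -> : enorm (x + y) ^+ 2 = enorm x ^+ 2 + enorm y ^+ 2 + 2 * dot x y.
  by rewrite !enorm_sqr /dot/=; ring.
have := le_trans (ler_norm _) (dot_le x y); lra.
Qed.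

Lemma enormN x : enorm (- x) = enorm x.
Proof. by rewrite /enorm/= !sqrrN. Qed.

Lemma enorm_distC x y : enorm (x - y) = enorm (y - x).
Proof. by rewrite -enormN opprB. Qed.

Lemma enorm_triangle x y z : enorm (x - z) <= enorm (x - y) + enorm (y - z).
Proof. by have := enormD (x - y) (y - z); rewrite addrA subrK. Qed.

Lemma enorm_subD y h : `|enorm (y + h) - enorm y| <= enorm h.
Proof.
have := enormD y h; have := enormD (y + h) (- h).
rewrite addrK enormN ler_norml; lra.
Qed.

Lemma coord_le_enorm x :
  [/\ `|x.1.1| <= enorm x, `|x.1.2| <= enorm x & `|x.2| <= enorm x].
Proof.
have := enorm_ge0 x; have := enorm_sqr x; rewrite /dot.
move: (enorm x) => e; move: x => [[x1 x2] x3] /= E e0.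
split; apply: le_of_sqr => //; rewrite real_normK ?num_real// E;
  have := sqr_ge0 x1; have := sqr_ge0 x2; have := sqr_ge0 x3; nra.
Qed.

(** The topology of the space is given by the sup norm, so this inequality is
    what turns Euclidean estimates into statements about neighbourhoods. *)
Lemma norm_le_enorm x : `|x| <= enorm x.
Proof.
have [? ? ?] := coord_le_enorm x; rewrite !prod_normE !ge_max.
by apply/andP; split => //; apply/andP.
Qed.

Lemma cvg_coords {T} {F : set_system T} {FF : Filter F} (f : T -> vec3 R) y :
  f x @[x --> F] --> y ->
  [/\ (f x).1.1 @[x --> F] --> y.1.1, (f x).1.2 @[x --> F] --> y.1.2
    & (f x).2 @[x --> F] --> y.2].
Proof.
move=> fy.
have f1 : (f x).1 @[x --> F] --> y.1.
  by apply: cvg_comp fy _; exact: cvg_fst.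
split.
- by apply: cvg_comp f1 _; exact: cvg_fst.
- by apply: cvg_comp f1 _; exact: cvg_snd.
- by apply: cvg_comp fy _; exact: cvg_snd.
Qed.

Lemma cvg_dot {T} {F : set_system T} {FF : Filter F} (f g : T -> vec3 R) y z :
  f x @[x --> F] --> y -> g x @[x --> F] --> z ->
  dot (f x) (g x) @[x --> F] --> dot y z.
Proof.
move=> /cvg_coords[f1 f2 f3] /cvg_coords[g1 g2 g3].
by apply: cvgD; [apply: cvgD|]; exact: cvgM.
Qed.

Lemma cvg_enorm {T} {F : set_system T} {FF : Filter F} (f : T -> vec3 R) y :
  f x @[x --> F] --> y -> enorm (f x) @[x --> F] --> enorm y.
Proof.
move=> fy; have enormE x : enorm x = Num.sqrt (dot x x).
  by rewrite -enorm_sqr sqrtr_sqr ger0_norm ?enorm_ge0.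
rewrite enormE; under eq_fun do rewrite enormE.
by apply: cvg_comp; [exact: (cvg_dot fy fy)|exact: sqrt_continuous].
Qed.

End EuclideanNorm.

(** * Measurability in the product sigma-algebra *)

Section Measurability.
Context {R : realType}.
Local Notation mR := (measurableTypeR R).
Local Notation mvec3 := (mR * mR * mR)%type.

Definition cube (a : vec3 R) (e : R) : set (vec3 R) :=
  ball a.1.1 e `*` ball a.1.2 e `*` ball a.2 e.

Lemma measurable_cube a e : measurable (cube a e : set mvec3).
Proof.
have mb (s d : R) : measurable (ball s d : set mR).
  by rewrite ball_itv; exact: measurable_itv.
by apply: measurableX; [apply: measurableX|]; exact: mb.
Qed.

(** An open set is the union of the cubes with rational centre and radius
    [1 / n.+1] that it contains: this is a countable union of measurable boxes
    for the product sigma-algebra. *)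
Lemma open_measurable3 (A : set (vec3 R)) :
  open A -> measurable (A : set mvec3).
Proof.
move=> oA.
pose center (q : rat * rat * rat) : vec3 R :=
  (ratr q.1.1, ratr q.1.2, ratr q.2).
pose rad (n : nat) : R := n.+1%:R^-1.
pose good (p : (rat * rat * rat) * nat) :=
  `[< cube (center p.1) (rad p.2) `<=` A >].
pose F p : set mvec3 := if good p then cube (center p.1) (rad p.2) else set0.
suff -> : (A : set mvec3) = \bigcup_p F p.
  apply: countable_bigcupT_measurable; first exact: countableP.
  by rewrite /F => p; case: ifP => // _; exact: measurable_cube.
apply/seteqP; split=> [x Ax|x [p _]]; last first.
  by rewrite /F; case: ifP => // /asboolP; exact.
have /nbhs_ballP[e /= e0 xeA] : nbhs (x : vec3 R) A by exact: open_nbhs_nbhs.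
(* Radius less than [e / 2], so that a cube containing [x] is in [ball x e]. *)
have [n ne] : exists n, rad n < e / 2.
  have [n ne] := ltr_add_invr (divr_gt0 e0 (ltr0n R 2)).
  by exists n; rewrite add0r in ne.
have rn : 0 < rad n by rewrite invr_gt0.
have approx (s : R) : exists q : rat, `|ratr q - s| < rad n.
  have [|q] := @rat_in_itvoo R (s - rad n) (s + rad n); first lra.
  by rewrite in_itv/= => q_; exists q; rewrite ltr_distl.
have [q1 h1] := approx x.1.1; have [q2 h2] := approx x.1.2.
have [q3 h3] := approx x.2.
exists ((q1, q2, q3), n); rewrite // /F.
have -> : good ((q1, q2, q3), n).
  apply/asboolP => y [[/= y1 y2] y3]; apply: xeA.
  have close (s t q : R) : `|q - s| < rad n -> `|q - t| < rad n -> `|s - t| < e.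
    rewrite !ltr_norml => /andP[? ?] /andP[? ?]; apply/andP; split; lra.
  split; [split|].
  - exact: close h1 y1.
  - exact: close h2 y2.
  - exact: close h3 y3.
by split; [split|].
Qed.

Lemma measurable_coord1 : measurable_fun setT ((fun x => x.1.1) : mvec3 -> mR).
Proof. exact: (measurableT_comp measurable_fst measurable_fst). Qed.

Lemma measurable_coord2 : measurable_fun setT ((fun x => x.1.2) : mvec3 -> mR).
Proof. exact: (measurableT_comp measurable_snd measurable_fst). Qed.

Lemma measurable_sub_coord (u : vec3 R) :
  [/\ measurable_fun setT ((fun x => (u - x).1.1) : mvec3 -> mR),
      measurable_fun setT ((fun x => (u - x).1.2) : mvec3 -> mR)
    & measurable_fun setT ((fun x => (u - x).2) : mvec3 -> mR)].
Proof.
split; apply: measurable_funB => //=.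
- exact: measurable_coord1.
- exact: measurable_coord2.
Qed.

Lemma measurable_inv_enorm (u : vec3 R) :
  measurable_fun setT ((fun x => (enorm (u - x))^-1) : mvec3 -> mR).
Proof.
have [m1 m2 m3] := measurable_sub_coord u.
(* Square root and inverse are both real powers of nonnegative numbers. *)
under eq_fun do rewrite -powR_inv1 ?enorm_ge0// /enorm -powR12_sqrt
  ?addr_ge0 ?sqr_ge0//.
apply: (measurableT_comp (measurable_powR _)).
apply: (measurableT_comp (measurable_powR _)).
by apply: measurable_funD; [apply: measurable_funD|]; exact: measurable_funX.
Qed.

End Measurability.

(** * Integrals against a weight that is nonnegative almost everywhere *)

Section WeightedIntegral.
Context d (T : measurableType d) (R : realType).
Variables (m : {measure set T -> \bar R}) (D : set T) (w : T -> R).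
Hypothesis mD : measurable D.
Hypothesis w_L1 : m.-integrable D (EFin \o w).
Hypothesis w_ge0 : {ae m, forall x, D x -> 0 <= w x}.

(** These functions are closed under sums and products, and integrable against
    any integrable weight. *)
Definition bounded_measurable (h : T -> R) :=
  measurable_fun D h /\ exists C, forall x, D x -> `|h x| <= C.

Lemma bounded_measurableD h1 h2 :
  bounded_measurable h1 -> bounded_measurable h2 ->
  bounded_measurable (fun x => h1 x + h2 x).
Proof.
move=> [m1 [C1 b1]] [m2 [C2 b2]]; split; first exact: measurable_funD.
exists (C1 + C2) => x Dx.
by rewrite (le_trans (ler_normD _ _))// lerD// ?b1 ?b2.
Qed.

Lemma bounded_measurableM h1 h2 :
  bounded_measurable h1 -> bounded_measurable h2 ->
  bounded_measurable (fun x => h1 x * h2 x).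
Proof.
move=> [m1 [C1 b1]] [m2 [C2 b2]]; split; first exact: measurable_funM.
by exists (C1 * C2) => x Dx; rewrite normrM ler_pM ?b1 ?b2.
Qed.

Lemma bounded_measurable_cst (k : R) : bounded_measurable (fun=> k).
Proof. by split; [exact: measurable_cst|exists `|k|]. Qed.

Lemma integrable_weighted h : bounded_measurable h ->
  m.-integrable D (EFin \o (fun x => w x * h x)).
Proof.
move=> [mh [C bC]].
have -> : EFin \o (fun x => w x * h x) = ((EFin \o w) \* (EFin \o h))%E.
  by apply/funext => x /=; rewrite EFinM.
apply: integrableMl => //; exists C; split; first exact: num_real.
by move=> K CK x Dx /=; rewrite (le_trans (bC x Dx))// ltW.
Qed.

Definition weighted (h : T -> R) : R := \int[m]_(x in D) (w x * h x).

Lemma weightedD h1 h2 : bounded_measurable h1 -> bounded_measurable h2 ->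
  weighted (fun x => h1 x + h2 x) = weighted h1 + weighted h2.
Proof.
move=> b1 b2; rewrite -RintegralD//; try exact: integrable_weighted.
by apply: eq_Rintegral => x _; rewrite mulrDr.
Qed.

Lemma weightedZ k h : bounded_measurable h ->
  weighted (fun x => k * h x) = k * weighted h.
Proof.
move=> b1; rewrite -RintegralZl//; last exact: integrable_weighted.
by apply: eq_Rintegral => x _; rewrite mulrCA.
Qed.

Lemma weighted_cst k : weighted (fun=> k) = k * \int[m]_(x in D) w x.
Proof.
by rewrite -RintegralZl//; apply: eq_Rintegral => x _; rewrite mulrC.
Qed.

(** Almost-everywhere nonnegativity of the weight becomes pointwise
    nonnegativity, so that integrals may be compared pointwise. *)
Lemma weighted_norm h : bounded_measurable h ->
  weighted h = \int[m]_(x in D) (`|w x| * h x).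
Proof.
move=> bh; congr fine.
have [mwh _] := integrableP _ _ _ (integrable_weighted bh).
have mw : measurable_fun D w.
  by have [/measurable_EFinP] := integrableP _ _ _ w_L1.
apply: ae_eq_integral => //.
  apply/measurable_EFinP; apply: measurable_funM; last by case: bh.
  exact: measurableT_comp.
by apply: filterS w_ge0 => x wx Dx; rewrite ger0_norm ?wx.
Qed.

Lemma le_weighted h1 h2 : bounded_measurable h1 -> bounded_measurable h2 ->
  (forall x, D x -> h1 x <= h2 x) -> weighted h1 <= weighted h2.
Proof.
have iw h : bounded_measurable h ->
    m.-integrable D (EFin \o (fun x => `|w x| * h x)).
  move=> bh; have := integrable_weighted bh; apply: le_integrable => //.
    apply/measurable_EFinP; apply: measurable_funM; last by case: bh.
    apply: measurableT_comp => //.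
    by have [/measurable_EFinP] := integrableP _ _ _ w_L1.
  by move=> x _ /=; rewrite lee_fin !normrM normr_id.
move=> b1 b2 h12; rewrite !weighted_norm//.
apply: le_Rintegral => //; try exact: iw.
by move=> x Dx; rewrite ler_wpM2l ?h12.
Qed.

Lemma weighted_norm_le h C : bounded_measurable h ->
  (forall x, D x -> `|h x| <= C) -> `|weighted h| <= C * \int[m]_(x in D) w x.
Proof.
move=> bh hC; rewrite ler_norml -mulNr -!weighted_cst; apply/andP; split.
- apply: le_weighted => //; first exact: bounded_measurable_cst.
  by move=> x /hC; rewrite ler_norml => /andP[].
- apply: le_weighted => //; first exact: bounded_measurable_cst.
  by move=> x /hC; rewrite ler_norml => /andP[].
Qed.

End WeightedIntegral.

(** * First-order expansion of the Newton kernel *)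

Section NewtonKernel.
Context {R : realType}.

(** The case [p = enorm y], [q = enorm (y + h)], [s = dot h y],
    [n = enorm h] is the first-order expansion of [1 / enorm] at [y], with a
    remainder that depends only on a lower bound [d] for both norms. *)
Lemma inv_taylor (d p q s n : R) : 0 < d -> d <= p -> d <= q ->
  q ^+ 2 = p ^+ 2 + 2 * s + n ^+ 2 -> `|s| <= n * p -> `|q - p| <= n ->
  `|q^-1 - p^-1 + s / p ^+ 3| <= 3 * n ^+ 2 / d ^+ 3.
Proof.
move=> d0 dp dq E sn qpn.
have p0 : 0 < p by lra.
have q0 : 0 < q by lra.
have n0 : 0 <= n by exact: le_trans qpn.
(* This comes from [1 / q - 1 / p = - (2 * s + n ^+ 2) / (p * q * (p + q))].
   The first summand is at most [n ^+ 2 / d ^+ 3] and the second at most twice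
   that, which is where the constant [3] comes from. *)
have -> : q^-1 - p^-1 + s / p ^+ 3
    = - (n ^+ 2 / (p * q * (p + q)))
      + s * (q - p) * (q + 2 * p) / (p ^+ 3 * q * (p + q)).
  have -> : n ^+ 2 = q ^+ 2 - p ^+ 2 - 2 * s by lra.
  by field; rewrite !gt_eqF//; lra.
have -> : 3 * n ^+ 2 / d ^+ 3 = n ^+ 2 / d ^+ 3 + 2 * (n ^+ 2 / d ^+ 3).
  by field; rewrite gt_eqF.
have d3 : 0 < d ^+ 3 by rewrite exprn_gt0.
have bound (a b : R) : 0 <= a -> d ^+ 3 <= b -> a / b <= a / d ^+ 3.
  by move=> a0 db; rewrite ler_wpM2l// lef_pV2 ?posrE//; lra.
apply: (le_trans (ler_normD _ _)); apply: lerD.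
- have pqd : d ^+ 3 <= p * q * (p + q).
    rewrite (exprSr _ 2) expr2; apply: ler_pM; rewrite ?mulr_ge0 ?ler_pM//; lra.
  rewrite normrN ger0_norm; first by apply: bound; rewrite ?sqr_ge0.
  by rewrite divr_ge0 ?sqr_ge0//; lra.
- rewrite 2!normrM normfV normrM [X in _ / X]ger0_norm; last first.
    by rewrite !mulr_ge0 ?exprn_ge0//; lra.
  rewrite (ger0_norm (_ : 0 <= q + 2 * p)); last lra.
  apply: (@le_trans _ _ ((n * p) * n * (q + 2 * p) / (p ^+ 3 * q * (p + q)))).
    rewrite ler_wpM2r ?invr_ge0 ?mulr_ge0 ?exprn_ge0//; try lra.
    rewrite ler_wpM2r//; first lra.
    exact: ler_pM.
  have -> : (n * p) * n * (q + 2 * p) / (p ^+ 3 * q * (p + q))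
      = (n ^+ 2 / (p ^+ 2 * q)) * ((q + 2 * p) / (p + q)).
    by field; rewrite !gt_eqF//; lra.
  rewrite mulrC; apply: ler_pM.
  + by rewrite divr_ge0//; lra.
  + by rewrite divr_ge0 ?sqr_ge0 ?mulr_ge0 ?exprn_ge0//; lra.
  + by rewrite ler_pdivrMr; lra.
  + apply: bound; first exact: sqr_ge0.
    rewrite (exprSr _ 2); apply: ler_pM => //; rewrite ?exprn_ge0//; try lra.
    by rewrite lerXn2r// nnegrE; lra.
Qed.

Lemma inv_enorm_taylor (d : R) (u w x : vec3 R) : 0 < d ->
  d <= enorm (w - x) -> d <= enorm (u - x) ->
  `|(enorm (u - x))^-1 - (enorm (w - x))^-1
     + dot (u - w) (w - x) / enorm (w - x) ^+ 3|
    <= 3 * enorm (u - w) ^+ 2 / d ^+ 3.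
Proof.
move=> d0 dw du; apply: inv_taylor => //.
- by rewrite !enorm_sqr /dot/=; ring.
- exact: dot_le.
- have -> : u - x = (w - x) + (u - w) by rewrite [RHS]addrC addrA subrK.
  exact: enorm_subD.
Qed.

End NewtonKernel.

(** * The Newtonian potential *)

Section Distance.
Context {R : realType}.
Implicit Types (u x : vec3 R) (A : set (vec3 R)).

Lemma has_lbound_dist u A : has_lbound [set enorm (u - y) | y in A].
Proof. by exists 0 => _ [y _ <-]; exact: enorm_ge0. Qed.

Lemma dist_le u A x : A x -> dist u A <= enorm (u - x).
Proof. by move=> Ax; apply: ge_inf; [exact: has_lbound_dist|exists x]. Qed.

Lemma dist_closure_gt0 u A : A !=set0 -> ~ closure A u ->
  0 < dist u (closure A).
Proof.
move=> [a Aa] nu.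
have [e e0 ue] : exists2 e : R, 0 < e & ball u e `<=` ~` closure A.
  have : nbhs u (~` closure A).
    apply: open_nbhs_nbhs; split => //.
    by apply: closed_openC; exact: closed_closure.
  by move=> /nbhs_ballP.
apply: (lt_le_trans e0); apply: lb_le_inf.
  by exists (enorm (u - a)), a => //; exact: subset_closure.
move=> _ [y cy <-]; rewrite leNgt; apply/negP => uy.
apply: (ue y) => //; rewrite -ball_normE/=.
exact: le_lt_trans (norm_le_enorm _) uy.
Qed.

End Distance.

Section Potential.
Context {R : realType}.
Variables (G : R) (Omega : set (vec3 R)) (mu : vec3 R -> R).
Hypothesis G_ge0 : 0 <= G.
Hypothesis Omega_open : open Omega.
Hypothesis mu_L1 : (leb3 R).-integrable Omega (EFin \o mu).
Hypothesis mu_ge0 : {ae leb3 R, forall x, Omega x -> 0 <= mu x}.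

Local Notation M := (mass Omega mu).
Local Notation wint := (weighted (leb3 R) Omega mu).
Local Notation mR := (measurableTypeR R).
Local Notation mvec3 := (mR * mR * mR)%type.
Local Notation bm h := (@bounded_measurable _ mvec3 R Omega h).

(** The Newtonian potential, without the factor [G] and with positive sign. *)
Definition potential (u : vec3 R) : R := wint (fun x => (enorm (u - x))^-1).

Let mOmega := open_measurable3 Omega_open.

Lemma bounded_measurable_inv_enorm (d : R) (u : vec3 R) : 0 < d ->
  (forall x, Omega x -> d <= enorm (u - x)) ->
  bm (fun x => (enorm (u - x))^-1).
Proof.
move=> d0 du; split.
  by apply: measurable_funTS; exact: measurable_inv_enorm.
exists d^-1 => x /du dux; rewrite ger0_norm ?invr_ge0 ?enorm_ge0//.
by rewrite lef_pV2// posrE//; lra.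
Qed.

Lemma bounded_measurable_field (d : R) (u : vec3 R) : 0 < d ->
  (forall x, Omega x -> d <= enorm (u - x)) ->
  [/\ bm (fun x => (u - x).1.1 / enorm (u - x) ^+ 3),
      bm (fun x => (u - x).1.2 / enorm (u - x) ^+ 3)
    & bm (fun x => (u - x).2 / enorm (u - x) ^+ 3)].
Proof.
move=> d0 du; have bi := bounded_measurable_inv_enorm d0 du.
have [m1 m2 m3] := measurable_sub_coord u.
have key (pr : vec3 R -> R) :
    measurable_fun setT (pr : mvec3 -> mR) ->
    (forall x, `|pr x| <= enorm (u - x)) ->
    bm (fun x => pr x / enorm (u - x) ^+ 3).
  move=> mpr prle.
  (* The first factor is bounded by [1], the other two by [d^-1]. *)
  have -> : (fun x => pr x / enorm (u - x) ^+ 3) =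
      (fun x => pr x * (enorm (u - x))^-1
                * ((enorm (u - x))^-1 * (enorm (u - x))^-1)).
    by apply/funext => x; rewrite -[(_ ^+ 3)^-1]exprVn (exprS _ 2) expr2 !mulrA.
  apply: bounded_measurableM; last exact: bounded_measurableM.
  split.
    have [mi _] := bi; apply: measurable_funM => //.
    exact: measurable_funTS mpr.
  exists 1 => x /du dux; rewrite normrM normfV (ger0_norm (enorm_ge0 _)).
  by rewrite ler_pdivrMr ?mul1r//; lra.
by split; apply: key => // x; case: (coord_le_enorm (u - x)).
Qed.

(** Pairing with a fixed vector turns the vector-valued integral into one
    scalar integral, the linear term in the expansion of the potential. *)
Lemma dot_acceleration (d : R) (u h : vec3 R) : 0 < d ->
  (forall x, Omega x -> d <= enorm (u - x)) ->
  bm (fun x => dot h (u - x) / enorm (u - x) ^+ 3) /\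
  dot h (acceleration G Omega mu u) =
    - G * wint (fun x => dot h (u - x) / enorm (u - x) ^+ 3).
Proof.
move=> d0 du; have [b1 b2 b3] := bounded_measurable_field d0 du.
have comp (pr : vec3 R -> R) : bm (fun x => pr x / enorm (u - x) ^+ 3) ->
    Rintegral (leb3 R) Omega (fun x => G * mu x / enorm (u - x) ^+ 3 * pr x)
    = G * wint (fun x => pr x / enorm (u - x) ^+ 3).
  move=> bpr; rewrite -weightedZ//; apply: eq_Rintegral => x _.
  by ring.
have split3 : (fun x => dot h (u - x) / enorm (u - x) ^+ 3) =
    (fun x => h.1.1 * ((u - x).1.1 / enorm (u - x) ^+ 3)
      + h.1.2 * ((u - x).1.2 / enorm (u - x) ^+ 3)
      + h.2 * ((u - x).2 / enorm (u - x) ^+ 3)).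
  by apply/funext => x; rewrite /dot; ring.
have bZ k g : bm g -> bm (fun x => k * g x).
  by move=> bg; apply: bounded_measurableM => //; exact: bounded_measurable_cst.
rewrite split3; split.
  by apply: bounded_measurableD; [apply: bounded_measurableD|]; exact: bZ.
rewrite weightedD//; [|by apply: bounded_measurableD; exact: bZ|exact: bZ].
rewrite weightedD//; [|exact: bZ..].
rewrite !weightedZ//.
have -> : acceleration G Omega mu u =
  (- (G * wint (fun x => (u - x).1.1 / enorm (u - x) ^+ 3)),
   - (G * wint (fun x => (u - x).1.2 / enorm (u - x) ^+ 3)),
   - (G * wint (fun x => (u - x).2 / enorm (u - x) ^+ 3))).
  by rewrite -!comp.
by rewrite /dot/=; ring.
Qed.

Lemma potential_le (d : R) (u : vec3 R) : 0 < d ->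
  (forall x, Omega x -> d <= enorm (u - x)) -> potential u <= M / d.
Proof.
move=> d0 du; rewrite mulrC -weighted_cst//.
apply: le_weighted => //; first exact: bounded_measurable_inv_enorm du.
  exact: bounded_measurable_cst.
by move=> x /du dux; rewrite lef_pV2// posrE//; lra.
Qed.

Lemma potential_ge (d K : R) (u : vec3 R) : 0 < d ->
  (forall x, Omega x -> d <= enorm (u - x) <= K) -> M / K <= potential u.
Proof.
move=> d0 du; rewrite mulrC -weighted_cst//.
apply: le_weighted => //; first exact: bounded_measurable_cst.
  by apply: (bounded_measurable_inv_enorm d0) => x /du /andP[].
by move=> x /du /andP[? ?]; rewrite lef_pV2// posrE//; lra.
Qed.

(** The acceleration is the gradient of [G * potential].  The remainder is
    quadratic because it is so uniformly in [x] under the integral. *)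
Lemma potential_taylor (d : R) (u w : vec3 R) : 0 < d ->
  (forall x, Omega x -> d <= enorm (u - x)) ->
  (forall x, Omega x -> d <= enorm (w - x)) ->
  `|G * potential u - G * potential w
     - dot (u - w) (acceleration G Omega mu w)|
    <= G * M * (3 / d ^+ 3) * enorm (u - w) ^+ 2.
Proof.
move=> d0 du dw; have [b ->] := dot_acceleration (u - w) d0 dw.
have bu := bounded_measurable_inv_enorm d0 du.
have bw := bounded_measurable_inv_enorm d0 dw.
have bN : bm (fun x => -1 * (enorm (w - x))^-1).
  by apply: bounded_measurableM => //; exact: bounded_measurable_cst.
have -> : G * potential u - G * potential w
    - (- G * wint (fun x => dot (u - w) (w - x) / enorm (w - x) ^+ 3))
  = G * wint (fun x => (enorm (u - x))^-1 + -1 * (enorm (w - x))^-1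
                + dot (u - w) (w - x) / enorm (w - x) ^+ 3).
  rewrite weightedD//; last exact: bounded_measurableD.
  by rewrite weightedD// weightedZ// /potential; ring.
rewrite normrM ger0_norm//.
have -> : G * M * (3 / d ^+ 3) * enorm (u - w) ^+ 2
  = G * (3 * enorm (u - w) ^+ 2 / d ^+ 3 * M) by ring.
rewrite ler_wpM2l//; apply: weighted_norm_le => //.
  by apply: bounded_measurableD => //; exact: bounded_measurableD.
move=> x Ox; rewrite mulN1r; apply: inv_enorm_taylor => //.
  exact: dw.
exact: du.
Qed.

End Potential.

(** * Conservation of energy *)

Section EnergyConservation.
Context {R : realType}.

Definition slope (V : lmodType R) (f : R -> V) (t t' : R) : V :=
  (t' - t)^-1 *: (f t' - f t).

Lemma slopeK (V : lmodType R) (f : R -> V) (t t' : R) :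
  t' != t -> f t' = f t + (t' - t) *: slope f t t'.
Proof.
by move=> tt'; rewrite /slope scalerA mulfV ?subr_eq0// scale1r addrC subrK.
Qed.

Lemma cvg_slope_cvg (V : normedModType R) (f : R -> V) (t : R) (l : V) :
  slope f t t' @[t' --> t^'] --> l -> f t' @[t' --> t^'] --> f t.
Proof.
move=> sl.
have -> : f t = f t + (t - t) *: l by rewrite subrr scale0r addr0.
have : f t + (t' - t) *: slope f t t' @[t' --> t^'] --> f t + (t - t) *: l.
  apply: cvgD; first exact: cvg_cst.
  apply: cvgZ => //; apply: cvgB; last exact: cvg_cst.
  exact: cvg_within.
apply: cvg_trans; apply: near_eq_cvg; near=> t'.
rewrite -slopeK//; near: t'; exact: nbhs_dnbhs_neq.
Unshelve. all: by end_near. Qed.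

Lemma is_derive_slope (f : R -> R) (t l : R) :
  slope f t t' @[t' --> t^'] --> l -> is_derive t 1 f l.
Proof.
move=> sl.
have hl : h^-1 *: ((f \o shift t) (h *: 1) - f t) @[h --> 0^'] --> l.
  have -> : (fun h => h^-1 *: ((f \o shift t) (h *: 1) - f t)) =
            slope f t \o shift t.
    by apply/funext => h; rewrite /slope/= addrK -[h *: 1]/(h * 1) mulr1.
  apply: cvg_comp sl.
  have -> : t^' = (shift t 0)^' by rewrite /= add0r.
  apply: continuous_injective_withinNx; last by move=> y /addIr.
  by apply: cvgD; [exact: cvg_id|exact: cvg_cst].
by split; [apply/cvg_ex; exists l|exact: cvg_lim hl].
Qed.

Variables (G : R) (Omega : set (vec3 R)) (mu : vec3 R -> R).
Hypothesis G_ge0 : 0 <= G.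
Hypothesis Omega_neq0 : Omega !=set0.
Hypothesis Omega_open : open Omega.
Hypothesis mu_L1 : (leb3 R).-integrable Omega (EFin \o mu).
Hypothesis mu_ge0 : {ae leb3 R, forall x, Omega x -> 0 <= mu x}.

Local Notation Phi := (potential Omega mu).
Local Notation acc := (acceleration G Omega mu).

(** Chain rule for the potential along a curve: dividing the expansion of the
    potential by [t' - t] leaves the error [err], which tends to [0] since the
    slopes of the curve stay bounded. *)
Lemma slope_potential (u : R -> vec3 R) (t : R) (v : vec3 R) :
  ~ closure Omega (u t) -> slope u t t' @[t' --> t^'] --> v ->
  slope (fun t' => G * Phi (u t')) t t' @[t' --> t^'] --> dot v (acc (u t)).
Proof.
move=> out sl.
(* Half the distance, so that points close to [u t] are still [d] away from
   the matter, as the expansion of the potential requires. *)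
set d := dist (u t) (closure Omega) / 2.
have dist0 := dist_closure_gt0 Omega_neq0 out.
have d0 : 0 < d by rewrite divr_gt0.
have far x : Omega x -> 2 * d <= enorm (u t - x).
  move=> Ox; rewrite mulrC divfK ?pnatr_eq0//.
  by apply: dist_le; exact: subset_closure.
have cu := cvg_slope_cvg sl.
set K := G * mass Omega mu * (3 / d ^+ 3).
pose err t' := K * dot (slope u t t') (slope u t t') * `|t' - t|.
have err0 : err t' @[t' --> t^'] --> 0.
  have -> : 0 = K * dot v v * `|t - t| by rewrite subrr normr0 mulr0.
  apply: cvgM; first by apply: cvgM; [exact: cvg_cst|exact: cvg_dot].
  by apply: cvg_norm; apply: cvgB; [exact: cvg_within|exact: cvg_cst].
have lin : dot (slope u t t') (acc (u t)) @[t' --> t^'] --> dot v (acc (u t)).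
  by apply: cvg_dot => //; exact: cvg_cst.
apply: (@squeeze_cvgr _ _ _ _
  (fun t' => dot (slope u t t') (acc (u t)) - err t')
  (fun t' => dot (slope u t t') (acc (u t)) + err t')); last 2 first.
- by rewrite -[X in _ --> X]subr0; exact: cvgB.
- by rewrite -[X in _ --> X]addr0; exact: cvgD.
have close : \forall t' \near t^', enorm (u t' - u t) < d.
  have : enorm (u t' - u t) @[t' --> t^'] --> enorm (u t - u t).
    by apply: cvg_enorm; apply: cvgB => //; exact: cvg_cst.
  by rewrite subrr enorm0 => /cvgr_lt; exact.
near=> t'.
have tt' : t' != t by near: t'; exact: nbhs_dnbhs_neq.
have ud : enorm (u t' - u t) < d by near: t'.
have far' x : Omega x -> d <= enorm (u t' - x).
  move=> /far; have := enorm_triangle (u t) (u t') x.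
  by rewrite (enorm_distC (u t) (u t')); lra.
have far0 x : Omega x -> d <= enorm (u t - x) by move=> /far; lra.
have := potential_taylor G_ge0 Omega_open mu_L1 mu_ge0 d0 far' far0.
rewrite -/K enorm_sqr.
have uw : u t' - u t = (t' - t) *: slope u t t'.
  by rewrite /slope scalerA mulfV ?subr_eq0// scale1r.
have errE : err t' = K * dot (slope u t t') (slope u t t') * `|t' - t| by [].
rewrite uw {uw} errE {errE}; move: (slope u t t') => w.
rewrite !dotZl (dotC w (_ *: _)) dotZl mulrA -expr2.
rewrite -(real_normK (num_real (t' - t))).
have tn0 : 0 < `|t' - t| by rewrite normr_gt0 subr_eq0.
have e : slope (fun t'0 => G * Phi (u t'0)) t t' - dot w (acc (u t))
    = (t' - t)^-1 *
      (G * Phi (u t') - G * Phi (u t) - (t' - t) * dot w (acc (u t))).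
  by rewrite mulrBr mulKf ?subr_eq0.
move=> taylor.
have : `|slope (fun t'0 => G * Phi (u t'0)) t t' - dot w (acc (u t))|
    <= K * dot w w * `|t' - t|.
  rewrite e normrM normfV mulrC ler_pdivrMr// (le_trans taylor)//.
  by rewrite le_eqVlt; apply/orP; left; apply/eqP; ring.
by rewrite ler_distl => /andP[? ?]; apply/andP; split; lra.
Unshelve. all: by end_near. Qed.

Definition energy (u v : R -> vec3 R) (t : R) : R :=
  dot (v t) (v t) / 2 - G * Phi (u t).

(** The slope of the kinetic energy tends to [dot (acc (u t)) (v t)], which
    the slope of the potential cancels. *)
Lemma is_derive_energy (A : set R) (u v : R -> vec3 R) (t : R) :
  newtonian_on G Omega mu A u v -> A° t -> ~ closure Omega (u t) ->
  is_derive t 1 (energy u v) 0.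
Proof.
move=> [a [du dv _] aE] At out.
have A_t : A t by exact: interior_subset.
have full : within A t^' = t^'.
  apply/seteqP; split=> P; rewrite /within/= => PA; last first.
    by apply: filterS PA => s.
  have : \forall s \near t^', A s by exact: nbhs_dnbhs.
  by move=> As; near=> s; apply: (near PA s) => //; near: s.
have su := du t A_t; have sv := dv t A_t; rewrite full in su sv.
rewrite aE// in sv.
apply: is_derive_slope.
have -> : 0 = dot (acc (u t)) (v t + v t) / 2 - dot (v t) (acc (u t)).
  by rewrite /dot/=; field.
have := slope_potential out su => sP.
have cv := cvg_slope_cvg sv.
have sK : dot (slope v t t') (v t' + v t) / 2 @[t' --> t^']
    --> dot (acc (u t)) (v t + v t) / 2.
  apply: cvgM; last exact: cvg_cst.
  by apply: cvg_dot => //; apply: cvgD => //; exact: cvg_cst.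
have -> : slope (energy u v) t = (fun t' =>
    dot (slope v t t') (v t' + v t) / 2 - slope (fun s => G * Phi (u s)) t t').
  apply/funext => t'; rewrite /slope /energy /dot/=.
  by rewrite -![_ *: _]/(_ * _); ring.
exact: cvgB.
Unshelve. all: by end_near. Qed.

Lemma energy_constant (A : set R) (u v : R -> vec3 R) (a b : R) :
  newtonian_on G Omega mu A u v -> a <= b ->
  (forall t, a <= t <= b -> A° t /\ ~ closure Omega (u t)) ->
  energy u v a = energy u v b.
Proof.
move=> N ab inside.
have dE t : a <= t <= b -> is_derive t 1 (energy u v) 0.
  by move=> /inside[At out]; exact: is_derive_energy N At out.
have [| |c _ /eqP] := @MVT_segment R (energy u v) (fun=> 0) a b ab.
- by move=> t; rewrite in_itv/= => /andP[? ?]; apply: dE; rewrite !ltW.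
- apply: derivable_within_continuous => t; rewrite in_itv/= => tab.
  by have [] := dE t tab.
- by rewrite mul0r subr_eq0 => /eqP ->.
Qed.

End EnergyConservation.

(** * Free flights and their starting times *)

Section Times.
Context {R : realType}.

Lemma cvg_right_end (V : topologicalType) (A : set R) (f : R -> V) (a b : R) :
  {within A, continuous f} -> a < b -> (forall t, a <= t < b -> A t) ->
  f t @[t --> a^'+] --> f a.
Proof.
move=> /subspace_continuousP cf ab sub.
have Aa : A a by apply: sub; rewrite lexx.
apply: cvg_trans (cf a Aa); apply: cvg_app => P; rewrite /within/= => PA.
have {}PA : \forall t \near a^'+, A t -> P t by exact: cvg_within.
near=> t; apply: (near PA t) => //; apply: sub.
apply/andP; split; near: t; [|exact: nbhs_right_lt].
exact: nbhs_right_ge.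
Unshelve. all: by end_near. Qed.

Lemma interior_sub_itv (A : set R) (a b t : R) :
  `]a, b[ `<=` A -> a < t < b -> A° t.
Proof.
move=> sub tab; apply: (filterS sub).
by apply: open_nbhs_nbhs; split; [exact: interval_open|rewrite /= in_itv].
Qed.

(** The set [F] of times is relatively open in the half-line from [t0], so its
    component at [s] is an interval that extends to the right of [s] and can
    contain its left end only if that is [t0]. *)
Lemma component_ends (F : set R) (t0 s : R) (I := connected_component F s)
    (a := inf I) :
  (forall t, F t -> t0 <= t) ->
  (forall t, F t -> exists2 e, 0 < e &
    forall t', t0 <= t' -> `|t' - t| < e -> F t') ->
  F s ->
  [/\ t0 <= a <= s, exists2 b, s < b & `]a, b[ `<=` I & F a -> a = t0].
Proof.
move=> Fge Fopen Fs.
have Is : I s by exact: connected_component_refl.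
have IF : I `<=` F by exact: connected_component_sub.
have Iitv : is_interval I.
  by apply/connected_intervalP; exact: component_connected.
have Ilb : lbound I t0 by move=> x /IF /Fge.
have hI : has_lbound I by exists t0.
have as_ : a <= s by apply: ge_inf.
have join x y z : x <= y -> `[x, y] `<=` F -> I z -> x <= z <= y ->
    `[x, y] `<=` I.
  move=> xy sub Iz zxy t txy; apply: connected_component_trans Iz _.
  apply: (@connected_component_max _ _ `[x, y] z) => //.
  exact: segment_connected.
have inI t : a < t <= s -> I t.
  move=> /andP[at_ ts]; have [y Iy yt] := inf_lt (ex_intro _ s Is) at_.
  by apply: (Iitv y s) => //; rewrite (ltW yt).
split.
- by rewrite as_ andbT; apply: lb_le_inf => //; exists s.
- have [e e0 Fe] := Fopen s Fs; exists (s + e); first by rewrite ltrDl.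
  move=> t; rewrite /= in_itv/= => /andP[at_ tse].
  have [ts|st] := leP t s; first by apply: inI; rewrite at_.
  apply: (join s t s); rewrite ?lexx ?ltW//=; last by rewrite in_itv/= lexx ltW.
  move=> x; rewrite /= in_itv/= => /andP[sx xt]; apply: Fe.
    exact: le_trans (Fge _ Fs) sx.
  by rewrite ger0_norm; lra.
- move=> Fa; apply/eqP; rewrite eq_le lb_le_inf ?andbT//; last by exists s.
  rewrite leNgt; apply/negP => t0a.
  have [e e0 Fe] := Fopen a Fa.
  pose x := Num.max t0 (a - e / 2).
  have xa : x < a by rewrite gt_max t0a; lra.
  have t0x : t0 <= x by rewrite le_max lexx.
  have aex : a - e / 2 <= x by rewrite le_max lexx orbT.
  have : I x.
    apply: (join x s s); rewrite ?lexx ?andbT//=;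
      [lra| |lra|by rewrite in_itv/= lexx; lra].
    move=> t; rewrite /= in_itv/= => /andP[xt ts].
    have [ta|at_] := leP t a; last by apply: IF; apply: inI; rewrite at_.
    by apply: Fe; [exact: le_trans xt|rewrite ler0_norm; lra].
  by move=> /(ge_inf hI); rewrite -/a leNgt xa.
Qed.

End Times.

(** * The bound on a free flight *)

Section Escape.
Context {R : realType}.

Lemma le_of_limit (f : R -> R) (k : R) :
  {for 0, continuous f} -> (forall e, 0 < e -> f e <= k) -> f 0 <= k.
Proof.
move=> cf fk; rewrite leNgt; apply/negP => kf.
have : \forall e \near 0^'+, k < f e.
  by apply: cvg_within; exact: (cvgr_gt (f 0) cf).
move=> kfe; have : \forall e \near (0 : R)^'+, False.
  near=> e; have := fk e _; rewrite leNgt (near kfe e)//.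
  by move=> /(_ _)/notF; apply.
by case/filter_ex.
Unshelve. all: by end_near. Qed.

Lemma limsup_speed_lt (v : R -> vec3 R) (a : R) (W : R) :
  (limsup_speed v a < W%:E)%E -> \forall t \near a^'+, enorm (v t) < W.
Proof.
move=> /ereal_inf_lt[_ [P aP <-] supW].
apply: filterS aP => t Pt; rewrite -lte_fin; apply: le_lt_trans supW.
by apply: ereal_sup_ubound; exists t.
Qed.

Variables (G : R) (Omega : set (vec3 R)) (mu : vec3 R -> R) (D : R).
Hypothesis G_gt0 : 0 < G.
Hypothesis Omega_neq0 : Omega !=set0.
Hypothesis Omega_open : open Omega.
Hypothesis mu_L1 : (leb3 R).-integrable Omega (EFin \o mu).
Hypothesis mu_ge0 : {ae leb3 R, forall x, Omega x -> 0 <= mu x}.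
Hypothesis D_gt0 : 0 < D.

Local Notation M := (mass Omega mu).
Local Notation d u := (dist u (closure Omega)).

Lemma dist_le_energy (u v : R -> vec3 R) (t : R) :
  ~ closure Omega (u t) -> - energy G Omega mu u v t * d (u t) <= G * M.
Proof.
move=> out; have d0 := dist_closure_gt0 Omega_neq0 out.
have : potential Omega mu (u t) <= M / d (u t).
  apply: (potential_le Omega_open mu_L1 mu_ge0) => // x Ox.
  by apply: dist_le; exact: subset_closure.
rewrite ler_pdivlMr// => /(ler_wpM2l (ltW G_gt0)).
apply: le_trans; rewrite mulrA ler_wpM2r ?(ltW d0)// /energy -enorm_sqr.
by have := sqr_ge0 (enorm (v t)); lra.
Qed.

Lemma energy_le (u v : R -> vec3 R) (t K W : R) :
  ~ closure Omega (u t) -> (forall x, Omega x -> enorm (u t - x) <= K) ->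
  enorm (v t) <= W -> energy G Omega mu u v t <= W ^+ 2 / 2 - G * M / K.
Proof.
move=> out uK vW; rewrite /energy -enorm_sqr; apply: lerB.
  rewrite ler_wpM2r ?invr_ge0// lerXn2r// nnegrE ?enorm_ge0//.
  exact: le_trans (enorm_ge0 _) vW.
rewrite -mulrA ler_wpM2l ?(ltW G_gt0)//.
have d0 := dist_closure_gt0 Omega_neq0 out.
apply: (potential_ge Omega_open mu_L1 mu_ge0 d0) => x Ox.
by rewrite uK// andbT; apply: dist_le; exact: subset_closure.
Qed.

(** The initial energy is bounded at times close to [a], where speed and
    distance to [ua] exceed their limits by less than [e]; it is the energy at
    [s], so that [e] can tend to [0] before the distance at [s] is compared. *)
Lemma free_flight_bound (A : set R) (u v : R -> vec3 R) (c a s : R)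
    (ua : vec3 R) :
  0 <= c -> c ^+ 2 * D < 2 * G * M ->
  newtonian_on G Omega mu A u v -> a < s ->
  (forall t, a < t <= s -> A° t /\ ~ closure Omega (u t)) ->
  u t @[t --> a^'+] --> ua -> (forall x, Omega x -> enorm (ua - x) <= D) ->
  (limsup_speed v a <= c%:E)%E ->
  d (u s) <= D / (1 - c ^+ 2 * D / (2 * G * M)).
Proof.
move=> c0 small N as_ inside ucvg uaD lim.
pose f (e : R) := G * M / (D + e) - (c + e) ^+ 2 / 2.
have fE e : 0 < e -> f e <= - energy G Omega mu u v s.
  move=> e0.
  have speed : \forall t \near a^'+, enorm (v t) < c + e.
    by apply: limsup_speed_lt; apply: le_lt_trans lim _; rewrite lte_fin ltrDl.
  have close : \forall t \near a^'+, enorm (u t - ua) < e.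
    have : enorm (u t - ua) @[t --> a^'+] --> enorm (ua - ua).
      by apply: cvg_enorm; apply: cvgB => //; exact: cvg_cst.
    by rewrite subrr enorm0 => /cvgr_lt; exact.
  have [t [tas vt ut]] : exists t, [/\ a < t <= s, enorm (v t) < c + e
      & enorm (u t - ua) < e].
    apply: (@filter_ex _ (a^'+)); near=> t; split; [|by near: t..].
    by apply/andP; split; near: t; [exact: nbhs_right_gt|exact: nbhs_right_le].
  have [/andP[at_ ts] [At out]] := (tas, inside t tas).
  have inside_ts t' : t <= t' <= s -> A° t' /\ ~ closure Omega (u t').
    by move=> /andP[tt' ?]; apply: inside; rewrite (lt_le_trans at_ tt').
  rewrite -(energy_constant (ltW G_gt0) Omega_neq0 Omega_open mu_L1 mu_ge0 N ts
    inside_ts).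
  have uK x : Omega x -> enorm (u t - x) <= D + e.
    by move=> /uaD; have := enorm_triangle (u t) ua x; lra.
  by have := energy_le out uK (ltW vt); rewrite /f; lra.
have f0 : f 0 <= - energy G Omega mu u v s.
  apply: le_of_limit => //; rewrite /f.
  apply: cvgB; last first.
    apply: cvgM; last exact: cvg_cst.
    have cD : c + e @[e --> (0 : R)] --> c + 0.
      by apply: cvgD; [exact: cvg_cst|exact: cvg_id].
    exact: (cvgM cD cD).
  apply: cvgM; first exact: cvg_cst.
  apply: cvgV; first by rewrite addr0 gt_eqF.
  by apply: cvgD; [exact: cvg_cst|exact: cvg_id].
have out : ~ closure Omega (u s) by apply: (inside s _).2; rewrite as_ lexx.
have d0 := dist_closure_gt0 Omega_neq0 out.
have GM0 : 0 < 2 * G * M.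
  by apply: le_lt_trans small; rewrite mulr_ge0 ?sqr_ge0// ltW.
have := dist_le_energy v out; move: f0; rewrite /f !addr0.
move: (energy _ _ _ _ _ _) (d (u s)) d0 => E x x0 f0 Ex.
have den0 : 0 < 1 - c ^+ 2 * D / (2 * G * M).
  by rewrite subr_gt0 ltr_pdivrMr// mul1r.
rewrite ler_pdivlMr//.
have fx : (G * M / D - c ^+ 2 / 2) * x <= G * M.
  by apply: le_trans Ex; rewrite ler_wpM2r ?(ltW x0).
have M_gt0 : 0 < M by rewrite -(pmulr_rgt0 _ G_gt0); lra.
move: fx; have -> : (G * M / D - c ^+ 2 / 2) * x
    = (G * M / D) * (x * (1 - c ^+ 2 * D / (2 * G * M))).
  by field; rewrite !gt_eqF.
by rewrite mulrAC ler_pdivrMr// ler_pM2l ?mulr_gt0.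
Unshelve. all: by end_near. Qed.

End Escape.

(** * Black holes *)

Section Ball.
Context {R : realType}.
Variables (b : vec3 R) (r : R).

Lemma dist_le_diam_eball x y :
  closed_eball b r x -> closed_eball b r y ->
  enorm (x - y) <= diam (closed_eball b r).
Proof.
move=> Bx By; apply: ub_le_sup; last by exists (x, y).
exists (r + r) => _ [[p q] [/= Bp Bq] <-].
apply: le_trans (enorm_triangle p b q) _.
by rewrite lerD// enorm_distC.
Qed.

(** The centre and a point of the sphere are at distance [r]. *)
Lemma diam_eball_gt0 : 0 < r -> 0 < diam (closed_eball b r).
Proof.
move=> r0; pose e : vec3 R := (r, 0, 0).
have er : enorm e = r.
  by rewrite /enorm/= expr0n/= !addr0 sqrtr_sqr gtr0_norm.
have := @dist_le_diam_eball (b + e) b; rewrite /closed_eball/=.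
rewrite subrr enorm0 addrAC subrr add0r er => H.
by apply: (lt_le_trans r0); apply: H; rewrite // ltW.
Qed.

Lemma ebounded_dist (A S : set (vec3 R)) (rho : R) :
  A !=set0 -> A `<=` closed_eball b r ->
  (forall x, S x -> dist x A <= rho) -> ebounded S.
Proof.
move=> [y0 Ay0] AB Srho; exists (rho + 1 + r + enorm b) => x Sx.
have [_ [y Ay <-] xy] : exists2 e, [set enorm (x - y) | y in A] e & e < rho + 1.
  apply: inf_lt; first by exists (enorm (x - y0)), y0.
  by apply: le_lt_trans (Srho x Sx) _; rewrite ltrDl.
have := AB y Ay; rewrite /closed_eball/= => yb.
have := enorm_triangle x y 0; have := enorm_triangle y b 0.
by rewrite !subr0; lra.
Qed.

End Ball.

Theorem corollary4p5 (R : realType) (G c : R)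
    (Omega : set (vec3 R)) (mu : vec3 R -> R) (b : vec3 R) (r : R)
    (M := mass Omega mu) (B := closed_eball b r)
    (G_gt0 : 0 < G) (c_gt0 : 0 < c)
    (Omega_neq0 : Omega !=set0) (Omega_bounded : ebounded Omega)
    (Omega_open : open Omega)
    (mu_L1 : (leb3 R).-integrable Omega (EFin \o mu))
    (mu_ge0 : {ae leb3 R, forall x, Omega x -> 0 <= mu x})
    (M_gt0 : 0 < M)
    (r_gt0 : 0 < r) (Omega_sub : closure Omega `<=` B)
    (small : c ^+ 2 * diam B < 2 * G * M) :
  black_hole G c Omega mu B /\
  forall (t0 : R) (T : \bar R) (u : R -> vec3 R),
    photon G c Omega mu B t0 T u ->
    (T < +oo)%E \/
    forall t, t0 <= t ->
      dist (u t) (closure Omega) <=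
        diam B / (1 - c ^+ 2 * diam B / (2 * G * M)).
Proof.
have D0 : 0 < diam B by exact: diam_eball_gt0.
have nearB y : B y -> forall x, Omega x -> enorm (y - x) <= diam B.
  move=> By x Ox; apply: dist_le_diam_eball => //.
  by apply: Omega_sub; exact: subset_closure.
have Omega_ne := Omega_neq0; have [x0 Ox0] := Omega_ne.
have GM0 : 0 < 2 * G * M by rewrite !mulr_gt0.
(* The bound is at least [diam B], so it holds trivially for points of [B]. *)
have distB y V : B y -> V ^+ 2 * diam B < 2 * G * M ->
    dist y (closure Omega) <= diam B / (1 - V ^+ 2 * diam B / (2 * G * M)).
  move=> By Vs; have q1 : V ^+ 2 * diam B / (2 * G * M) < 1.
    by rewrite ltr_pdivrMr// mul1r.
  have q0 : 0 <= V ^+ 2 * diam B / (2 * G * M).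
    exact: divr_ge0 (mulr_ge0 (sqr_ge0 V) (ltW D0)) (ltW GM0).
  apply: (@le_trans _ _ (diam B)).
    apply: le_trans (nearB y By x0 Ox0).
    by apply: dist_le; exact: subset_closure.
  by rewrite ler_pdivlMr ?subr_gt0//; nra.
split.
- (* [V ^+ 2] is half-way between [c ^+ 2] and the critical value. *)
  move=> u0 Bu0; pose V := Num.sqrt ((c ^+ 2 + 2 * G * M / diam B) / 2).
  have cX : c ^+ 2 < 2 * G * M / diam B by rewrite ltr_pdivlMr.
  have VE : V ^+ 2 = (c ^+ 2 + 2 * G * M / diam B) / 2.
    by rewrite sqr_sqrtr//; have := sqr_ge0 c; lra.
  have V0 : 0 <= V by exact: sqrtr_ge0.
  have cV : c < V by rewrite -(@ltr_pXn2r _ 2) ?nnegrE ?(ltW c_gt0)// VE; lra.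
  have Vsmall : V ^+ 2 * diam B < 2 * G * M by rewrite -ltr_pdivlMr// VE; lra.
  exists V => // T u [T0 cu u00 out [v N speed]].
  apply: (@ebounded_dist _ b r (closure Omega) _
    (diam B / (1 - V ^+ 2 * diam B / (2 * G * M)))) => //.
    by exists x0; exact: subset_closure.
  move=> _ [t [t0 tT] <-].
  have [->|tn0] := eqVneq t 0; first by rewrite u00; exact: distB.
  have tpos : 0 < t by rewrite lt_def tn0.
  have [s ts sT] : exists2 s : R, t < s & forall t', t' < s -> (t'%:E < T)%E.
    case: T {speed N out cu T0} tT => [T| |]//.
      by rewrite lte_fin => tT; exists T => // t'; rewrite lte_fin.
    by exists (t + 1); [rewrite ltrDl|move=> ? _; exact: ltry].
  apply: (@free_flight_bound _ G Omega mu (diam B) _ _ _ _ _ _ _ u v V 0 t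
    (u 0)) => //.
  + exact: N.
  + move=> t' /andP[t'0 t't]; split.
      apply: (@interior_sub_itv R _ 0 s t').
        by move=> x; rewrite /= in_itv/= => /andP[? ?]; split => //; exact: sT.
      by rewrite t'0 (le_lt_trans t't).
    by apply: out; split => //; apply: sT; exact: le_lt_trans t't ts.
  + apply: (cvg_right_end cu tpos) => t' /andP[? t't]; split => //.
    by apply: sT; exact: lt_trans ts.
  + by rewrite u00; exact: nearB.
  + exact: ltW.
- move=> t0 [T| |] u [t0T _ cu Bu0 free]; [by left; exact: ltry| |by left].
  right => s t0s.
  have [inM|out] := pselect (closure Omega (u s)).
    by apply: distB => //; exact: Omega_sub.
  set life := [set t : R | t0 <= t /\ (t%:E <= +oo)%E] in cu free.
  pose F := [set t | life t /\ ~ closure Omega (u t)].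
  have Fs : F s by split => //; split => //; exact: leey.
  have [v [N speed]] : exists v,
      newtonian_on G Omega mu (connected_component F s) u v /\
      (limsup_speed v (inf (connected_component F s)) <= c%:E)%E.
    by have [v ? ?] := free s Fs; exists v.
  have Fge t : F t -> t0 <= t by case; case.
  have Fopen t : F t -> exists2 e, 0 < e &
      forall t', t0 <= t' -> `|t' - t| < e -> F t'.
    move=> [tl tout].
    have : nbhs (u t) (~` closure Omega).
      apply: open_nbhs_nbhs; split => //.
      by apply: closed_openC; exact: closed_closure.
    move=> /((subspace_continuousP _ _).1 cu t tl).
    rewrite /within/= => /nbhs_ballP[e /= e0 sub]; exists e => // t' t0t' t't.
    have lt' : life t' by split => //; exact: leey.
    split => //; apply: sub => //.
    by rewrite -ball_normE/= distrC.
  have [/andP[t0a as_] [s' ss' sub] Fa] := component_ends Fge Fopen Fs.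
  set a := inf _ in t0a as_ sub Fa speed.
  have Bua : B (u a).
    have [/Omega_sub//|aout] := pselect (closure Omega (u a)).
    by rewrite Fa//; split => //; split => //; exact: leey.
  move: as_; rewrite le_eqVlt => /predU1P[<-|as_]; first exact: distB.
  apply: (@free_flight_bound _ G Omega mu (diam B) _ _ _ _ _ _ _ u v c a s
    (u a)) => //.
  + exact: ltW.
  + exact: N.
  + move=> t /andP[at_ ts].
    have ts' : a < t < s' by rewrite at_ (le_lt_trans ts).
    split; first exact: interior_sub_itv ts'.
    have : connected_component F s t by apply: sub; rewrite /= in_itv.
    by case/connected_component_sub.
  + apply: (cvg_right_end cu as_) => t /andP[at_ _].
    by split; [exact: le_trans at_|exact: leey].
  + exact: nearB.
Qed.
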